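(* Any log-aesthetic curve (LAC) with parameter $\alpha \neq 1$ and with positive and decreasing curvature can be expressed as a basic LAC after applying similarity transformations and a shift of the arc length parameter. In particular, let $L>0$, let $\alpha\in\mathbb{R}$ with $\alpha\neq 1$, and let $\gamma:[0,L]\to\mathbb{R}^2$ be an LAC of length $L$ (parameterized by arc length) with parameter $\alpha$ whose curvature is positive and decreasing. Then there exist unique $\gamma_0\in\mathbb{R}^2$, $\phi\in[0,2\pi)$, $S\in\mathbb{R}\setminus\{0\}$ and $s_0\in\mathbb{R}$ (that is, exactly one quadruple $(\gamma_0,\phi,S,s_0)$) such that $s/S+s_0\in I_\alpha$ for all $s\in[0,L]$ and $$\gamma(s)=\gamma_0+S\,\mathrm{R}_{\phi}\,\xi^{\alpha}(s/S+s_0),\qquad s\in[0,L],$$ where $\xi^\alpha:I_\alpha\to\mathbb{R}^2$ is the basic LAC with parameter $\alpha$, the segment of it that is used having length $l:=L/S$.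
   Context: Planar curves: let $\gamma(s)\in\mathbb{R}^2$ be a (sufficiently smooth) planar curve parameterized by arc length $s$. Write $'=d/ds$. The tangent vector is $T(s)=\gamma'(s)=(\cos\theta(s),\sin\theta(s))^{T}$, where $\theta(s)$ is the (continuous) turning angle measured from the horizontal axis. The signed curvature is $\kappa(s)=\theta'(s)$ and the radius of curvature is $\rho(s)=1/\kappa(s)$. $\mathrm{R}_\phi$ denotes the $2\times 2$ rotation matrix of angle $\phi$. Log-aesthetic curve (LAC): an arc length parameterized planar curve $\gamma(s)$ with strictly monotonic radius of curvature is called an LAC (with parameter $\alpha$) if its curvature satisfies $$\kappa\kappa''-(\alpha+1)(\kappa')^2=0$$ for some constant $\alpha\in\mathbb{R}$. Basic LAC: for $\alpha\in\mathbb{R}$, the basic LAC $\xi^\alpha$ is the LAC, defined on an open interval $I\subset\mathbb{R}$ containing $0$, satisfying $\kappa'(s)=-(\kappa(s))^{\alpha+1}<0$ for all $s\in I$, $\kappa(0)=1$, $\theta(0)=0$, and $\xi^\alpha(0)=0$. All basic LAC are taken to be defined on the maximal interval $I=I_\alpha$ on which $1+\alpha s>0$, namely $I_\alpha=(-\infty,-1/\alpha)$ if $\alpha<0$, $I_\alpha=(-\infty,\infty)$ if $\alpha=0$, and $I_\alpha=(-1/\alpha,\infty)$ if $\alpha>0$. Explicitly, the curvature of $\xi^\alpha$ is $\kappa_{\xi^\alpha}(s)=\exp(-s)$ if $\alpha=0$ and $\kappa_{\xi^\alpha}(s)=(1+\alpha s)^{-1/\alpha}$ if $\alpha\neq 0$;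 its turning angle is $\theta_{\xi^\alpha}(s)=\int_0^s\kappa_{\xi^\alpha}(t)\,dt$; and $$\xi^\alpha(s)=\int_0^s\begin{pmatrix}\cos\theta_{\xi^\alpha}(t)\\ \sin\theta_{\xi^\alpha}(t)\end{pmatrix}dt .$$ *)

(* Defs.v *)
From Stdlib Require Import Reals Lra.
From Coquelicot Require Import Coquelicot.
Open Scope R_scope.

Definition strictly_increasing_on (D : R -> Prop) (f : R -> R) : Prop :=
  forall s t, D s -> D t -> s < t -> f s < f t.

Definition strictly_decreasing_on (D : R -> Prop) (f : R -> R) : Prop :=
  forall s t, D s -> D t -> s < t -> f t < f s.

Definition strictly_monotonic_on (D : R -> Prop) (f : R -> R) : Prop :=
  strictly_increasing_on D f \/ strictly_decreasing_on D f.

Definition closed_interval (a b s : R) : Prop := a <= s <= b.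

Definition nondegenerate_interval (D : R -> Prop) : Prop :=
  (forall x y z, D x -> D z -> x <= y <= z -> D y) /\
  (exists x y, D x /\ D y /\ x < y).

(* [D_in f f' D s] is differentiability within [D]: it is one-sided at an
   endpoint of [D] and does not depend on the values of [f] outside [D]. *)
Definition derivative_on (D : R -> Prop) (f f' : R -> R) : Prop :=
  forall s, D s -> D_in f f' D s.

(* A curve with a turning angle is parameterized by arc length, since its
   derivative is [(cos theta, sin theta)]. *)
Definition is_turning_angle (D : R -> Prop) (gamma : R -> R * R)
    (theta : R -> R) : Prop :=
  derivative_on D (fun s => fst (gamma s)) (fun s => cos (theta s)) /\
  derivative_on D (fun s => snd (gamma s)) (fun s => sin (theta s)).

(* Continuity of the turning angle follows from its differentiability. *)
Definition is_curvature (D : R -> Prop) (gamma : R -> R * R)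
    (kappa : R -> R) : Prop :=
  exists theta : R -> R,
    is_turning_angle D gamma theta /\ derivative_on D theta kappa.

(* Log-aesthetic curve on [D] with parameter [alpha]; the curvature [kappa] is
   an explicit argument, determined on [D] by [gamma]. *)
Definition is_LAC (D : R -> Prop) (alpha : R) (gamma : R -> R * R)
    (kappa : R -> R) : Prop :=
  is_curvature D gamma kappa /\
  (forall s, D s -> kappa s <> 0) /\
  strictly_monotonic_on D (fun s => / kappa s) /\
  exists kappa' kappa'' : R -> R,
    derivative_on D kappa kappa' /\
    derivative_on D kappa' kappa'' /\
    forall s, D s ->
      kappa s * kappa'' s - (alpha + 1) * (kappa' s) ^ 2 = 0.

Definition I_basic (alpha s : R) : Prop := 0 < 1 + alpha * s.

Definition kappa_basic (alpha s : R) : R :=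
  if Req_EM_T alpha 0 then exp (- s) else Rpower (1 + alpha * s) (- (1 / alpha)).

Definition theta_basic (alpha s : R) : R := RInt (kappa_basic alpha) 0 s.

Definition xi (alpha s : R) : R * R :=
  (RInt (fun t => cos (theta_basic alpha t)) 0 s,
   RInt (fun t => sin (theta_basic alpha t)) 0 s).

Definition rotation (phi : R) (v : R * R) : R * R :=
  (cos phi * fst v - sin phi * snd v, sin phi * fst v + cos phi * snd v).

Definition similarity (v0 : R * R) (phi S : R) (v : R * R) : R * R :=
  (fst v0 + S * fst (rotation phi v), snd v0 + S * snd (rotation phi v)).

Definition is_basic_LAC_form (D : R -> Prop) (alpha : R) (gamma : R -> R * R)
    (gamma0 : R * R) (phi S s0 : R) : Prop :=
  0 <= phi < 2 * PI /\
  S <> 0 /\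
  (forall s, D s -> I_basic alpha (s / S + s0)) /\
  (forall s, D s -> gamma s = similarity gamma0 phi S (xi alpha (s / S + s0))).

(* [Rmin] and [Rmax] make this the length of the arc between the parameters
   [a] and [b] whatever their order, hence nonnegative. *)
Definition arc_length (c : R -> R * R) (a b : R) : R :=
  RInt (fun t => sqrt ((Derive (fun u => fst (c u)) t) ^ 2 +
                       (Derive (fun u => snd (c u)) t) ^ 2))
       (Rmin a b) (Rmax a b).

(* The explicit formulas above do give the LAC on [I_basic alpha] with
   [kappa' = - kappa ^ (alpha + 1)], [kappa 0 = 1], [theta 0 = 0], [xi 0 = 0]. *)

Lemma ex_derive_continuous_R (f : R -> R) (x : R) : ex_derive f x -> continuous f x.
Proof. exact (ex_derive_continuous f x). Qed.

Lemma kappa_basic_pos (alpha s : R) : 0 < kappa_basic alpha s.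
Proof.
unfold kappa_basic, Rpower; destruct (Req_EM_T alpha 0); apply exp_pos.
Qed.

Lemma kappa_basic_derive (alpha s : R) : I_basic alpha s ->
  is_derive (kappa_basic alpha) s (- Rpower (kappa_basic alpha s) (alpha + 1)).
Proof.
unfold I_basic, kappa_basic; intros H.
destruct (Req_EM_T alpha 0) as [->|Ha].
- rewrite Rplus_0_l, Rpower_1 by apply exp_pos.
  auto_derive; [easy | ring].
- rewrite Rpower_mult. unfold Rpower.
  auto_derive; [easy |].
  replace (- (1 / alpha) * (alpha + 1) * ln (1 + alpha * s))
    with (- (1 / alpha) * ln (1 + alpha * s) + - ln (1 + alpha * s))
    by (field; easy).
  rewrite exp_plus, exp_Ropp, exp_ln by easy.
  field; split; [lra | easy].
Qed.

Lemma I_basic_convex (alpha s t : R) : I_basic alpha s ->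
  Rmin 0 s <= t <= Rmax 0 s -> I_basic alpha t.
Proof.
unfold I_basic, Rmin, Rmax; intros H; destruct (Rle_dec 0 s); intros Ht;
  destruct (Rle_dec 0 alpha); nra.
Qed.

Lemma I_basic_locally (alpha s : R) : I_basic alpha s ->
  locally s (I_basic alpha).
Proof.
intros H.
assert (O : open (fun t => 0 < 1 + alpha * t)).
{ apply (open_comp (fun t : R => 1 + alpha * t) (fun y => 0 < y)).
  - intros x _; apply (ex_derive_continuous_R (fun t => 1 + alpha * t)).
    auto_derive; easy.
  - apply open_gt. }
now apply O.
Qed.

Lemma RInt_I_basic_derive (alpha s : R) (f : R -> R) :
  (forall t, I_basic alpha t -> continuous f t) -> I_basic alpha s ->
  is_derive (fun t => RInt f 0 t) s (f s).
Proof.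
intros Hf Hs; apply is_derive_RInt with 0; [| now apply Hf].
apply (filter_imp (I_basic alpha)); [| now apply I_basic_locally].
intros t Ht; apply RInt_correct, ex_RInt_continuous.
intros z Hz; apply Hf, (I_basic_convex alpha t); easy.
Qed.

Lemma theta_basic_derive (alpha s : R) : I_basic alpha s ->
  is_derive (theta_basic alpha) s (kappa_basic alpha s).
Proof.
apply RInt_I_basic_derive; intros t Ht.
apply ex_derive_continuous_R; eexists; now apply kappa_basic_derive.
Qed.

Lemma xi_derive (alpha s : R) : I_basic alpha s ->
  is_derive (fun t => fst (xi alpha t)) s (cos (theta_basic alpha s)) /\
  is_derive (fun t => snd (xi alpha t)) s (sin (theta_basic alpha s)).
Proof.
intros Hs; split;
  [ apply (RInt_I_basic_derive alpha s (fun t => cos (theta_basic alpha t)))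
  | apply (RInt_I_basic_derive alpha s (fun t => sin (theta_basic alpha t))) ];
  trivial; intros t Ht;
  [ apply (ex_derive_continuous_R (fun u => cos (theta_basic alpha u)))
  | apply (ex_derive_continuous_R (fun u => sin (theta_basic alpha u))) ];
  auto_derive; eexists; now apply theta_basic_derive.
Qed.

Lemma basic_initial (alpha : R) :
  kappa_basic alpha 0 = 1 /\ theta_basic alpha 0 = 0 /\ xi alpha 0 = (0, 0).
Proof.
split; [| split].
- unfold kappa_basic, Rpower; destruct (Req_EM_T alpha 0);
    rewrite ?Rmult_0_r, ?Rplus_0_r, ?ln_1, ?Rmult_0_r, ?Ropp_0; apply exp_0.
- apply (@RInt_point R_CompleteNormedModule).
- unfold xi; f_equal; apply (@RInt_point R_CompleteNormedModule).
Qed.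

Lemma derivative_on_is_derive (D : R -> Prop) (f f' : R -> R) :
  (forall s, D s -> is_derive f s (f' s)) -> derivative_on D f f'.
Proof.
intros H s Hs; apply D_in_imp with no_cond; [easy |].
now apply derivable_pt_lim_D_in, is_derive_Reals, H.
Qed.

Lemma xi_is_LAC (alpha : R) :
  is_LAC (I_basic alpha) alpha (xi alpha) (kappa_basic alpha).
Proof.
pose (k := kappa_basic alpha).
assert (Hd : forall s t, I_basic alpha s -> I_basic alpha t -> s < t ->
             k t < k s).
{ intros s t Hs Ht st.
  assert (HI : forall c, s <= c <= t -> I_basic alpha c).
  { unfold I_basic in *; intros c Hc; destruct (Rle_dec 0 alpha); nra. }
  destruct (MVT_gen k s t (fun c => - Rpower (k c) (alpha + 1)))
    as [c [Hc E]]; rewrite ?Rmin_left, ?Rmax_right in * by lra.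
  - intros c Hc; apply kappa_basic_derive, HI; lra.
  - intros c Hc; apply continuity_pt_filterlim, ex_derive_continuous_R.
    eexists; now apply kappa_basic_derive, HI.
  - assert (0 < Rpower (k c) (alpha + 1)) by apply exp_pos. nra. }
split; [| split; [| split]].
- exists (theta_basic alpha); split; [split |];
    apply derivative_on_is_derive; intros s Hs;
    [ exact (proj1 (xi_derive alpha s Hs))
    | exact (proj2 (xi_derive alpha s Hs))
    | exact (theta_basic_derive alpha s Hs) ].
- intros s _; apply Rgt_not_eq, kappa_basic_pos.
- left; intros s t Hs Ht st; apply Rinv_lt_contravar.
  + apply Rmult_lt_0_compat; apply kappa_basic_pos.
  + now apply Hd.
- exists (fun s => - Rpower (k s) (alpha + 1)).
  exists (fun s => (alpha + 1) * (Rpower (k s) (alpha + 1)) ^ 2 / k s).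
  assert (Hk : forall s, 0 < k s) by (intros; apply kappa_basic_pos).
  split; [| split].
  + apply derivative_on_is_derive; intros s Hs; now apply kappa_basic_derive.
  + apply derivative_on_is_derive; intros s Hs.
    pose proof (kappa_basic_derive alpha s Hs) as E; fold k in E.
    unfold Rpower at 1; auto_derive.
    * split; [eexists; exact E | split; [apply Hk | easy]].
    * replace (Derive (fun x => k x) s) with (- Rpower (k s) (alpha + 1))
        by (symmetry; now apply is_derive_unique).
      fold (Rpower (k s) (alpha + 1)); field; apply Rgt_not_eq, Hk.
  + intros s _; fold k; field; apply Rgt_not_eq, Hk.
Qed.

(* Main.v *)
Require Import Defs.
From Stdlib Require Import Reals Lra.
From Coquelicot Require Import Coquelicot.
Open Scope R_scope.

(** Along an LAC with curvature [k], the quantity [k' k^(-alpha-1)] is constant,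
    so [k' = - c k^(alpha+1)] with [c > 0] as [k] decreases.  Scaling a basic
    LAC by [S] turns the constant [1] into [S^(alpha-1)], so for [alpha <> 1]
    exactly one scale [S > 0] gives [c].  If [tau] denotes the inverse function
    of the basic curvature, [tau (S k)] then has derivative [1 / S], that is,
    [S k s] is the basic curvature at [s / S + s0]; integrating twice gives the
    turning angle and the curve.  Conversely, any representation of the curve
    determines its tangent direction, hence [k] (whose sign forces [S > 0]),
    then [S] from [c], [s0] from the injectivity of the basic curvature, and
    finally [phi] and [gamma0]. *)

(** * Derivatives within a subset of the line *)

Definition convex_on_line (D : R -> Prop) : Prop :=
  forall x y z, D x -> D z -> x <= y <= z -> D y.

Lemma D_in_is_derive_comp (D : R -> Prop) (f f' g : R -> R) (l s : R) :
  D_in f f' D s -> is_derive g (f s) l ->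
  D_in (fun x => g (f x)) (fun _ => l * f' s) D s.
Proof.
intros Hf Hg.
assert (Hg' : D_in g (fun _ => l) no_cond (f s))
  by (now apply derivable_pt_lim_D_in, is_derive_Reals).
assert (H := Dcomp D no_cond f' (fun _ => l) f g s Hf Hg').
rewrite Rmult_comm.
(* [D_in] evaluates its derivative argument only at the point [s], so the varying function here and
   the constant one in the goal are convertible. *)
apply (D_in_imp (fun x => g (f x)) (fun x => f' x * l)
         (Dgf D no_cond f) D s); [| exact H].
now intros x Hx; split.
Qed.

Lemma is_derive_D_in (D : R -> Prop) (f : R -> R) (l s : R) :
  is_derive f s l -> D_in f (fun _ => l) D s.
Proof.
intros H; apply D_in_imp with no_cond; [easy |].
now apply derivable_pt_lim_D_in, is_derive_Reals.
Qed.

(** A small enough [h] keeps [s + h] inside the open interval, so the limit within [D] is the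
    two-sided one. *)
Lemma D_in_interior (D : R -> Prop) (f f' : R -> R) (a b s : R) :
  (forall x, a < x < b -> D x) -> a < s < b -> D_in f f' D s ->
  is_derive f s (f' s).
Proof.
intros HD Hs H; apply is_derive_Reals; intros eps Heps.
destruct (H eps Heps) as [d [Hd Hlim]].
assert (Hm : 0 < Rmin d (Rmin (s - a) (b - s)))
  by (repeat apply Rmin_pos; lra).
exists (mkposreal _ Hm); intros h Hh Hlt; simpl in Hlt.
pose proof (Rmin_l d (Rmin (s - a) (b - s))).
pose proof (Rmin_r d (Rmin (s - a) (b - s))).
pose proof (Rmin_l (s - a) (b - s)).
pose proof (Rmin_r (s - a) (b - s)).
assert (Ha : - (Rmin d (Rmin (s - a) (b - s))) < h
             < Rmin d (Rmin (s - a) (b - s))) by (now apply Rabs_def2 in Hlt).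
specialize (Hlim (s + h)).
replace (s + h - s) with h in Hlim by ring.
apply Hlim; split.
- split; [apply HD; lra | lra].
- simpl; unfold Rdist; replace (s + h - s) with h by ring; lra.
Qed.

Lemma clamp_bounds (a b t : R) : a <= b -> a <= Rmax a (Rmin b t) <= b.
Proof.
intros H; split; [apply Rmax_l |].
apply Rmax_lub; [easy | apply Rmin_l].
Qed.

Lemma clamp_id (a b t : R) : a <= t <= b -> Rmax a (Rmin b t) = t.
Proof. intros H; rewrite Rmin_right, Rmax_right; lra. Qed.

Lemma clamp_lipschitz (a b t u : R) :
  a <= b -> Rabs (Rmax a (Rmin b t) - Rmax a (Rmin b u)) <= Rabs (t - u).
Proof.
intros H; unfold Rmax, Rmin.
repeat destruct Rle_dec; unfold Rabs; repeat destruct Rcase_abs; lra.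
Qed.

(* Precomposing with the clamp onto [[x, y]] replaces one-sided continuity at
   the endpoints by the two-sided continuity that [MVT_gen] asks for. *)
Lemma MVT_derivative_on (D : R -> Prop) (f f' : R -> R) (x y : R) :
  convex_on_line D -> derivative_on D f f' -> D x -> D y -> x < y ->
  exists z, D z /\ f y - f x = f' z * (y - x).
Proof.
intros HD Hf Hx Hy Hxy.
assert (Hin : forall t, x <= t <= y -> D t) by (intros t Ht; now apply (HD x t y)).
pose (g := fun t => f (Rmax x (Rmin y t))).
destruct (MVT_gen g x y f') as [z [Hz E]];
  rewrite ?Rmin_left, ?Rmax_right in * by lra.
- intros t Ht.
  apply is_derive_ext_loc with f.
  + apply (locally_interval _ t x y); simpl; [lra | lra |].
    intros u Hu1 Hu2; unfold g; rewrite clamp_id; lra.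
  + apply D_in_interior with D x y; [intros u Hu; apply Hin; lra | lra |].
    apply Hf, Hin; lra.
- intros t Ht eps Heps.
  assert (Hc : D_in f f' D t) by (apply Hf, Hin; lra).
  apply cont_deriv in Hc.
  destruct (Hc eps Heps) as [d [Hd Hlim]].
  exists d; split; [easy |].
  intros u [_ Hu]; simpl in Hu |- *; unfold Rdist in *.
  unfold g; rewrite (clamp_id x y t) by lra.
  (* Continuity within [D] is a limit over points other than [t], so the case where clamping yields
     [t] itself is separate. *)
  destruct (Req_EM_T (Rmax x (Rmin y u)) t) as [-> | Hne].
  + now rewrite Rminus_diag, Rabs_R0.
  + apply Hlim; split.
    * split; [apply Hin, clamp_bounds; lra | now apply not_eq_sym].
    * simpl; unfold Rdist.
      rewrite <- (clamp_id x y t) by lra.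
      eapply Rle_lt_trans; [apply clamp_lipschitz; lra | easy].
- exists z; split; [now apply Hin |].
  unfold g in E; now rewrite !clamp_id in E by lra.
Qed.

(** The mean value theorem makes the difference constant. Each integration in the existence proof
    goes through this: the first integral, the shift of the parameter, the turning angle and both
    coordinates. *)
Lemma eq_derivative_on (D : R -> Prop) (f g h : R -> R) (x y : R) :
  convex_on_line D -> derivative_on D f h -> derivative_on D g h ->
  D x -> D y -> f x - g x = f y - g y.
Proof.
intros HD Hf Hg.
assert (H : derivative_on D (fun t => f t - g t) (fun t => h t - h t))
  by (intros t Ht; apply Dminus; auto).
assert (Hlt : forall u v, D u -> D v -> u < v -> f u - g u = f v - g v).
{ intros u v Hu Hv Huv.
  destruct (MVT_derivative_on D _ _ u v HD H Hu Hv Huv) as [z [_ E]].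
  replace (h z - h z) with 0 in E by ring; lra. }
intros Hx Hy; destruct (Rtotal_order x y) as [L | [-> | L]]; auto.
symmetry; auto.
Qed.

(** * Real powers and angles *)

Lemma is_derive_Rpower (p x : R) :
  0 < x -> is_derive (fun t => Rpower t p) x (p * Rpower x (p - 1)).
Proof.
intros H; apply is_derive_Reals; exact (derivable_pt_lim_power x p H).
Qed.

Lemma Rpower_root (c p : R) : 0 < c -> p <> 0 -> Rpower (Rpower c (1 / p)) p = c.
Proof.
intros Hc Hp; rewrite Rpower_mult.
replace (1 / p * p) with 1 by (now field); now apply Rpower_1.
Qed.

Lemma Rpower_inj_base (p a b : R) :
  p <> 0 -> 0 < a -> 0 < b -> Rpower a p = Rpower b p -> a = b.
Proof.
intros Hp Ha Hb E.
assert (E' : Rpower (Rpower a p) (1 / p) = Rpower (Rpower b p) (1 / p))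
  by now rewrite E.
rewrite !Rpower_mult in E'.
replace (p * (1 / p)) with 1 in E' by (now field).
now rewrite !Rpower_1 in E'.
Qed.

(** [acos (cos x)] has the right cosine and the sine [Rabs (sin x)]; for negative [sin x] the
    reflected angle [2 * PI - acos (cos x)] corrects the sign. *)
Lemma angle_exists (x : R) :
  exists phi, 0 <= phi < 2 * PI /\ cos phi = cos x /\ sin phi = sin x.
Proof.
pose proof (COS_bound x) as Hb.
pose proof (acos_bound (cos x)) as Ha.
pose proof PI_RGT_0 as Hpi.
pose proof (cos_acos (cos x) Hb) as Hc.
pose proof (sin_acos (cos x) Hb) as Hs.
replace (1 - (cos x)²) with ((sin x)²) in Hs by (rewrite sin2; ring).
rewrite sqrt_Rsqr_abs in Hs.
destruct (Rle_lt_dec 0 (sin x)) as [H | H].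
- exists (acos (cos x)); rewrite Rabs_right in Hs by lra.
  split; [lra | easy].
- rewrite Rabs_left in Hs by easy.
  exists (2 * PI - acos (cos x)); split; [split; [lra |] | split].
  (* [acos (cos x) = 0] would give the excluded angle [2 * PI], but then the sine would vanish,
     against [sin x < 0]. *)
  + destruct (proj1 Ha) as [L | E]; [lra |].
    rewrite <- E, sin_0 in Hs; lra.
  + rewrite cos_minus, cos_2PI, sin_2PI, Hc; ring.
  + rewrite sin_minus, cos_2PI, sin_2PI, Hs; ring.
Qed.

(** [cos (a - b) = 1] forces [sin ((a - b) / 2) = 0], and the half difference lies strictly between
    [- PI] and [PI], where only [0] has sine zero. *)
Lemma angle_unique (a b : R) :
  0 <= a < 2 * PI -> 0 <= b < 2 * PI -> cos a = cos b -> sin a = sin b -> a = b.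
Proof.
intros Ha Hb Hc Hs.
assert (Hd : cos (a - b) = 1).
{ rewrite cos_minus, Hc, Hs; pose proof (sin2_cos2 b) as H; unfold Rsqr in H; lra. }
replace (a - b) with (2 * ((a - b) / 2)) in Hd by field.
rewrite cos_2a_sin in Hd.
assert (H0 : sin ((a - b) / 2) = 0) by nra.
destruct (Rtotal_order a b) as [L | [E | L]]; [| easy |].
- assert (0 < sin (- ((a - b) / 2))) by (apply sin_gt_0; lra).
  rewrite sin_neg in *; lra.
- assert (0 < sin ((a - b) / 2)) by (apply sin_gt_0; lra); lra.
Qed.

Lemma cos_sin_plus_cancel (a b t : R) :
  cos (a + t) = cos (b + t) -> sin (a + t) = sin (b + t) ->
  cos a = cos b /\ sin a = sin b.
Proof.
intros Hc Hs.
replace a with ((a + t) - t) by ring; replace b with ((b + t) - t) by ring.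
now rewrite !cos_minus, !sin_minus, Hc, Hs.
Qed.

(** * The inverse function of the basic curvature, called [tau] in the overview *)

Definition kappa_basic_inv (alpha k : R) : R :=
  if Req_EM_T alpha 0 then - ln k else (Rpower k (- alpha) - 1) / alpha.

Lemma kappa_basic_inv_I (alpha k : R) : I_basic alpha (kappa_basic_inv alpha k).
Proof.
unfold I_basic, kappa_basic_inv; destruct (Req_EM_T alpha 0) as [-> | Ha]; [lra |].
replace (1 + alpha * ((Rpower k (- alpha) - 1) / alpha))
  with (Rpower k (- alpha)) by (now field).
apply exp_pos.
Qed.

Lemma kappa_basic_invK (alpha k : R) :
  0 < k -> kappa_basic alpha (kappa_basic_inv alpha k) = k.
Proof.
intros Hk; unfold kappa_basic, kappa_basic_inv.
destruct (Req_EM_T alpha 0) as [_ | Ha].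
- now rewrite Ropp_involutive, exp_ln.
- replace (1 + alpha * ((Rpower k (- alpha) - 1) / alpha))
    with (Rpower k (- alpha)) by (now field).
  rewrite Rpower_mult; replace (- alpha * - (1 / alpha)) with 1 by (now field).
  now apply Rpower_1.
Qed.

Lemma kappa_basicK (alpha s : R) :
  I_basic alpha s -> kappa_basic_inv alpha (kappa_basic alpha s) = s.
Proof.
unfold I_basic, kappa_basic, kappa_basic_inv; intros Hs.
destruct (Req_EM_T alpha 0) as [_ | Ha].
- rewrite ln_exp; ring.
- rewrite Rpower_mult; replace (- (1 / alpha) * - alpha) with 1 by (now field).
  rewrite Rpower_1 by easy; now field.
Qed.

(** One formula serves both cases: for [alpha = 0] the power is [/ k], which gives the derivative of
    [- ln k]. *)
Lemma kappa_basic_inv_derive (alpha k : R) :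
  0 < k -> is_derive (kappa_basic_inv alpha) k (- Rpower k (- alpha - 1)).
Proof.
intros Hk; unfold kappa_basic_inv; destruct (Req_EM_T alpha 0) as [-> | Ha].
- replace (-0 - 1) with (- (1)) by ring.
  rewrite Rpower_Ropp, Rpower_1 by easy.
  auto_derive; [easy | field; lra].
- pose proof (is_derive_Rpower (- alpha) k Hk) as H.
  apply is_derive_ext with (fun t => / alpha * (Rpower t (- alpha) + - 1)).
  + intros t; apply Rmult_comm.
  + replace (- Rpower k (- alpha - 1))
      with (/ alpha * (- alpha * Rpower k (- alpha - 1) + 0)) by (now field).
    apply is_derive_scal.
    apply (is_derive_plus (V := R_NormedModule)); [easy |].
    apply (is_derive_const (V := R_NormedModule)).
Qed.

(** * The first integral of the LAC equation *)

Lemma LAC_first_integral (D : R -> Prop) (alpha : R)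
    (kappa kappa' kappa'' : R -> R) :
  nondegenerate_interval D ->
  derivative_on D kappa kappa' -> derivative_on D kappa' kappa'' ->
  (forall s, D s -> kappa s * kappa'' s - (alpha + 1) * kappa' s ^ 2 = 0) ->
  (forall s, D s -> 0 < kappa s) -> strictly_decreasing_on D kappa ->
  exists c, 0 < c /\ forall s, D s -> kappa' s = - c * Rpower (kappa s) (alpha + 1).
Proof.
intros [HD [x [y [Hx [Hy Hxy]]]]] H1 H2 Hode Hpos Hdec.
(* The derivative of [w] is [Rpower (kappa s) (- (alpha + 1) - 1)] times the left side of the LAC
   equation, hence zero. *)
pose (w := fun s => kappa' s * Rpower (kappa s) (- (alpha + 1))).
assert (Hw : derivative_on D w (fun _ => 0)).
{ intros s Hs; specialize (Hode s Hs); specialize (Hpos s Hs).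
  pose proof (D_in_is_derive_comp D kappa kappa' _ _ s (H1 s Hs)
                (is_derive_Rpower (- (alpha + 1)) _ Hpos)) as Hp.
  pose proof (Dmult D _ _ _ _ s (H2 s Hs) Hp) as Hm.
  unfold D_in in *; cbv beta in *.
  match type of Hm with limit1_in _ _ ?l _ => replace 0 with l; [exact Hm |] end.
  replace (Rpower (kappa s) (- (alpha + 1)))
    with (kappa s * Rpower (kappa s) (- (alpha + 1) - 1)).
  - replace (kappa'' s * (kappa s * Rpower (kappa s) (- (alpha + 1) - 1)) +
      kappa' s * (- (alpha + 1) * Rpower (kappa s) (- (alpha + 1) - 1) * kappa' s))
      with (Rpower (kappa s) (- (alpha + 1) - 1) *
            (kappa s * kappa'' s - (alpha + 1) * kappa' s ^ 2)) by ring.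
    rewrite Hode; ring.
  - rewrite <- (Rpower_1 (kappa s)) at 1 by easy.
    rewrite <- Rpower_plus; f_equal; ring. }
assert (Hconst : forall s, D s -> kappa' s = w x * Rpower (kappa s) (alpha + 1)).
{ intros s Hs.
  assert (E : w x = w s).
  { pose proof (eq_derivative_on D w (fun _ => 0) (fun _ => 0) x s HD Hw) as E.
    cbv beta in E.
    enough (w x - 0 = w s - 0) by lra.
    apply E; trivial; intros t Ht; apply is_derive_D_in.
    apply (is_derive_const (V := R_NormedModule)). }
  rewrite E; unfold w; rewrite Rmult_assoc, <- Rpower_plus.
  replace (- (alpha + 1) + (alpha + 1)) with 0 by ring.
  rewrite Rpower_O by auto; ring. }
exists (- w x); split.
(* The chord of [kappa] from [x] to [y] has negative slope, which is a value of [kappa'], and the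
   sign of [kappa'] is that of [w x]. *)
- destruct (MVT_derivative_on D _ _ x y HD H1 Hx Hy Hxy) as [z [Hz E]].
  specialize (Hdec x y Hx Hy Hxy); rewrite (Hconst z Hz) in E.
  assert (0 < Rpower (kappa z) (alpha + 1)) by apply exp_pos.
  destruct (Rlt_le_dec (w x) 0) as [L | L]; [lra |].
  assert (0 <= w x * Rpower (kappa z) (alpha + 1)) by nra; nra.
- intros s Hs; rewrite Ropp_involutive; auto.
Qed.

(** * Similar images of the basic LAC, and existence of the representation *)

Lemma affine_derive (S s0 s : R) : is_derive (fun u => u / S + s0) s (/ S).
Proof. unfold Rdiv; auto_derive; [easy | ring]. Qed.

Lemma is_derive_comp_affine (f : R -> R) (S s0 s l : R) :
  is_derive f (s / S + s0) l -> is_derive (fun u => f (u / S + s0)) s (/ S * l).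
Proof.
intros H; apply (is_derive_comp f (fun u => u / S + s0)); [easy |].
apply affine_derive.
Qed.

(** The factor [/ S] from the parameter cancels the scale [S], whatever its sign, so the image keeps
    unit speed and the rotation adds [phi] to the turning angle. *)
Lemma similarity_xi_derive (alpha : R) (gamma0 : R * R) (phi S s0 s : R) :
  S <> 0 -> I_basic alpha (s / S + s0) ->
  is_derive (fun u => fst (similarity gamma0 phi S (xi alpha (u / S + s0)))) s
    (cos (phi + theta_basic alpha (s / S + s0))) /\
  is_derive (fun u => snd (similarity gamma0 phi S (xi alpha (u / S + s0)))) s
    (sin (phi + theta_basic alpha (s / S + s0))).
Proof.
intros HS HI.
destruct (xi_derive alpha _ HI) as [H1 H2].
apply is_derive_comp_affine in H1; apply is_derive_comp_affine in H2.
pose (f := fun u : R => fst (xi alpha (u / S + s0))).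
pose (g := fun u : R => snd (xi alpha (u / S + s0))).
rewrite cos_plus, sin_plus; unfold similarity, rotation; simpl fst; simpl snd.
split.
- apply is_derive_ext with
    (fun u => fst gamma0 + S * (cos phi * f u - sin phi * g u)); [easy |].
  auto_derive; [split; [eexists; exact H1 | split; [eexists; exact H2 | easy]] |].
  rewrite (is_derive_unique (fun x : R => f x) s _ H1),
    (is_derive_unique (fun x : R => g x) s _ H2); now field.
- apply is_derive_ext with
    (fun u => snd gamma0 + S * (sin phi * f u + cos phi * g u)); [easy |].
  auto_derive; [split; [eexists; exact H1 | split; [eexists; exact H2 | easy]] |].
  rewrite (is_derive_unique (fun x : R => f x) s _ H1),
    (is_derive_unique (fun x : R => g x) s _ H2); now field.
Qed.

Lemma basic_curvature_exists (D : R -> Prop) (alpha c : R) (kappa kappa' : R -> R) :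
  alpha <> 1 -> nondegenerate_interval D -> derivative_on D kappa kappa' ->
  (forall s, D s -> 0 < kappa s) -> 0 < c ->
  (forall s, D s -> kappa' s = - c * Rpower (kappa s) (alpha + 1)) ->
  exists S s0, 0 < S /\ forall s, D s ->
    I_basic alpha (s / S + s0) /\ S * kappa s = kappa_basic alpha (s / S + s0).
Proof.
intros Ha [HD [x [_ [Hx _]]]] Hk Hpos Hc Hode.
(* The solution of [Rpower S (alpha - 1) = c]; this is where [alpha <> 1] enters. *)
pose (S := Rpower c (1 / (alpha - 1))).
assert (HS : 0 < S) by apply exp_pos.
assert (HSc : Rpower S (alpha - 1) = c) by (apply Rpower_root; lra).
assert (Ht : derivative_on D (fun s => kappa_basic_inv alpha (S * kappa s))
               (fun _ => / S)).
{ intros s Hs; specialize (Hpos s Hs).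
  assert (Hp : 0 < S * kappa s) by now apply Rmult_lt_0_compat.
  assert (Hd : is_derive (fun k => kappa_basic_inv alpha (S * k)) (kappa s)
                 (S * - Rpower (S * kappa s) (- alpha - 1))).
  { apply (is_derive_comp (kappa_basic_inv alpha) (fun k => S * k)).
    - now apply kappa_basic_inv_derive.
    - auto_derive; [easy | ring]. }
  pose proof (D_in_is_derive_comp D kappa kappa' _ _ s (Hk s Hs) Hd) as H.
  rewrite (Hode s Hs) in H.
  replace (/ S) with (S * - Rpower (S * kappa s) (- alpha - 1) *
                      (- c * Rpower (kappa s) (alpha + 1))); [exact H |].
  rewrite <- HSc, <- Rpower_mult_distr by easy.
  (* The exponents of [S] sum to [-2], which with the leading [S] leaves [/ S]; those of [kappa s]
     sum to [0]. *)
  replace (S * - (Rpower S (- alpha - 1) * Rpower (kappa s) (- alpha - 1)) *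
      (- Rpower S (alpha - 1) * Rpower (kappa s) (alpha + 1)))
    with (S * (Rpower S (- alpha - 1) * Rpower S (alpha - 1)) *
          (Rpower (kappa s) (- alpha - 1) * Rpower (kappa s) (alpha + 1))) by ring.
  rewrite <- !Rpower_plus.
  replace (- alpha - 1 + (alpha - 1)) with (- (1 + 1)) by ring.
  replace (- alpha - 1 + (alpha + 1)) with 0 by ring.
  rewrite Rpower_Ropp, Rpower_plus, Rpower_1, Rpower_O by easy.
  field; lra. }
(* The shift makes [s / S + s0] agree with the inverse basic curvature of [S * kappa s] at [s = x];
   the common derivative [/ S] carries the agreement to all of [D]. *)
exists S, (kappa_basic_inv alpha (S * kappa x) - x / S); split; [easy |].
intros s Hs.
assert (E : s / S + (kappa_basic_inv alpha (S * kappa x) - x / S) =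
            kappa_basic_inv alpha (S * kappa s)).
{ pose proof (eq_derivative_on D _ (fun u => u / S + 0) _ x s HD Ht) as E.
  cbv beta in E.
  enough (kappa_basic_inv alpha (S * kappa x) - (x / S + 0) =
          kappa_basic_inv alpha (S * kappa s) - (s / S + 0)) by lra.
  apply E; trivial; intros t _; apply is_derive_D_in, affine_derive. }
rewrite E; split; [apply kappa_basic_inv_I |].
rewrite kappa_basic_invK; [easy | apply Rmult_lt_0_compat; auto].
Qed.

Lemma basic_LAC_form_exists (D : R -> Prop) (alpha : R)
    (gamma : R -> R * R) (kappa : R -> R) :
  alpha <> 1 -> nondegenerate_interval D -> is_LAC D alpha gamma kappa ->
  (forall s, D s -> 0 < kappa s) -> strictly_decreasing_on D kappa ->
  exists (gamma0 : R * R) (phi S s0 : R),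
    is_basic_LAC_form D alpha gamma gamma0 phi S s0.
Proof.
intros Ha HD [[theta [[Hg1 Hg2] Hth]] [_ [_ [k1 [k2 [Hk1 [Hk2 Hode]]]]]]] Hpos Hdec.
destruct (LAC_first_integral D alpha kappa k1 k2) as [c [Hc Hode1]]; trivial.
destruct (basic_curvature_exists D alpha c kappa k1) as [S [s0 [HS Hb]]]; trivial.
destruct HD as [HD [x [_ [Hx _]]]].
(* The constant offset between the two turning angles is the rotation, reduced here modulo
   [2 * PI]. *)
destruct (angle_exists (theta x - theta_basic alpha (x / S + s0)))
  as [phi [Hphi [Ec Es]]].
assert (Hang : forall s, D s ->
  theta s = (theta x - theta_basic alpha (x / S + s0)) +
            theta_basic alpha (s / S + s0)).
{ intros s Hs.
  pose proof (eq_derivative_on D theta (fun u => theta_basic alpha (u / S + s0))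
                kappa x s HD Hth) as E; cbv beta in E.
  rewrite E; trivial; [ring |].
  intros t Ht; destruct (Hb t Ht) as [HI Ek].
  pose proof (is_derive_comp_affine _ S s0 t _
                (theta_basic_derive alpha _ HI)) as Hd.
  replace (/ S * kappa_basic alpha (t / S + s0)) with (kappa t) in Hd
    by (rewrite <- Ek; field; lra).
  exact (is_derive_D_in D _ _ _ Hd). }
(* The candidate curve without translation; [gamma0] will be the difference of [gamma] and [sigma]
   at [x]. *)
pose (sigma := fun s => similarity (0, 0) phi S (xi alpha (s / S + s0))).
assert (Hd : forall s, D s ->
  is_derive (fun u => fst (sigma u)) s (cos (theta s)) /\
  is_derive (fun u => snd (sigma u)) s (sin (theta s))).
{ intros s Hs; destruct (Hb s Hs) as [HI _].
  (* [phi] may differ from the offset by a multiple of [2 * PI], so it is substituted only under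
     [cos] and [sin]. *)
  rewrite (Hang s Hs), cos_plus, sin_plus, <- Ec, <- Es, <- cos_plus, <- sin_plus.
  apply similarity_xi_derive; [lra | easy]. }
exists (fst (gamma x) - fst (sigma x), snd (gamma x) - snd (sigma x)), phi, S, s0.
split; [easy |]; split; [lra |]; split; [intros s Hs; now apply Hb |].
intros s Hs.
assert (E1 : fst (gamma x) - fst (sigma x) = fst (gamma s) - fst (sigma s)).
{ apply (eq_derivative_on D (fun u => fst (gamma u)) (fun u => fst (sigma u))
           (fun u => cos (theta u))); trivial.
  intros t Ht; exact (is_derive_D_in D _ _ _ (proj1 (Hd t Ht))). }
assert (E2 : snd (gamma x) - snd (sigma x) = snd (gamma s) - snd (sigma s)).
{ apply (eq_derivative_on D (fun u => snd (gamma u)) (fun u => snd (sigma u))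
           (fun u => sin (theta u))); trivial.
  intros t Ht; exact (is_derive_D_in D _ _ _ (proj2 (Hd t Ht))). }
rewrite E1, E2; unfold sigma, similarity; simpl fst; simpl snd.
rewrite (surjective_pairing (gamma s)) at 1; f_equal; simpl; ring.
Qed.

(** * Uniqueness of the representation *)

(** Differentiating the common unit vector gives [k] and [l] times the same unit normal. Comparing
    directions avoids showing that the two angles differ by a constant. *)
Lemma derive_angle_eq (theta psi : R -> R) (k l s : R) :
  is_derive theta s k -> is_derive psi s l ->
  locally s (fun u => cos (theta u) = cos (psi u) /\ sin (theta u) = sin (psi u)) ->
  k = l.
Proof.
intros Ht Hp Hloc.
pose proof (locally_singleton _ _ Hloc) as [Ec Es].
assert (Hc : - sin (theta s) * k = - sin (psi s) * l).
{ rewrite <- (is_derive_unique (fun u : R => cos (theta u)) s (- sin (theta s) * k)).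
  - apply is_derive_unique.
    apply is_derive_ext_loc with (fun u => cos (psi u)).
    + apply filter_imp with (2 := Hloc); now intros u [-> _].
    + auto_derive; [eexists; exact Hp |].
      rewrite (is_derive_unique (fun u : R => psi u) _ _ Hp); ring.
  - auto_derive; [eexists; exact Ht |].
    rewrite (is_derive_unique (fun u : R => theta u) _ _ Ht); ring. }
assert (Hs : cos (theta s) * k = cos (psi s) * l).
{ rewrite <- (is_derive_unique (fun u : R => sin (theta u)) s (cos (theta s) * k)).
  - apply is_derive_unique.
    apply is_derive_ext_loc with (fun u => sin (psi u)).
    + apply filter_imp with (2 := Hloc); now intros u [_ ->].
    + auto_derive; [eexists; exact Hp |].
      rewrite (is_derive_unique (fun u : R => psi u) _ _ Hp); ring.
  - auto_derive; [eexists; exact Ht |].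
    rewrite (is_derive_unique (fun u : R => theta u) _ _ Ht); ring. }
rewrite Ec in Hs; rewrite Es in Hc.
pose proof (sin2_cos2 (psi s)) as H1; unfold Rsqr in H1.
(* Taking the inner product with the unit normal [(- sin (psi s), cos (psi s))] isolates [k]. *)
replace k with (sin (psi s) * (sin (psi s) * k) + cos (psi s) * (cos (psi s) * k))
  by (transitivity ((sin (psi s) * sin (psi s) + cos (psi s) * cos (psi s)) * k);
      [ring | rewrite H1; ring]).
replace (sin (psi s) * k) with (sin (psi s) * l) by lra.
rewrite Hs.
transitivity ((sin (psi s) * sin (psi s) + cos (psi s) * cos (psi s)) * l);
  [ring | rewrite H1; ring].
Qed.

(** At interior points derivatives are two-sided, so those of [gamma] and of the representing curve
    coincide, up to the derivative of the curvature. The last formula identifies the constant [c] of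
    the first integral as [Rpower S (alpha - 1)]. *)
Lemma basic_LAC_form_interior (D : R -> Prop) (a b alpha : R)
    (gamma : R -> R * R) (theta kappa kappa' : R -> R)
    (gamma0 : R * R) (phi S s0 : R) :
  a < b -> (forall s, a < s < b -> D s) ->
  is_turning_angle D gamma theta -> derivative_on D theta kappa ->
  derivative_on D kappa kappa' -> (forall s, D s -> 0 < kappa s) ->
  is_basic_LAC_form D alpha gamma gamma0 phi S s0 ->
  0 < S /\ forall s, a < s < b ->
    cos (theta s) = cos (phi + theta_basic alpha (s / S + s0)) /\
    sin (theta s) = sin (phi + theta_basic alpha (s / S + s0)) /\
    S * kappa s = kappa_basic alpha (s / S + s0) /\
    kappa' s = - Rpower S (alpha - 1) * Rpower (kappa s) (alpha + 1).
Proof.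
intros Hab HD [Hg1 Hg2] Hth Hk Hpos [_ [HS [HI Hg]]].
assert (Hloc : forall (P : R -> Prop) s, a < s < b ->
          (forall u, a < u < b -> P u) -> locally s P).
{ intros P s Hs HP; apply (locally_interval P s a b); simpl; [lra | lra |].
  intros u Hu1 Hu2; apply HP; simpl in *; lra. }
assert (Hdir : forall s, a < s < b ->
  cos (theta s) = cos (phi + theta_basic alpha (s / S + s0)) /\
  sin (theta s) = sin (phi + theta_basic alpha (s / S + s0))).
{ intros s Hs.
  destruct (similarity_xi_derive alpha gamma0 phi S s0 s HS (HI s (HD s Hs)))
    as [Hx1 Hx2].
  pose proof (D_in_interior D _ _ a b s HD Hs (Hg1 s (HD s Hs))) as Hd1.
  pose proof (D_in_interior D _ _ a b s HD Hs (Hg2 s (HD s Hs))) as Hd2.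
  cbv beta in Hd1, Hd2.
  split.
  - rewrite <- (is_derive_unique _ _ _ Hd1), <- (is_derive_unique _ _ _ Hx1).
    apply Derive_ext_loc, Hloc; [easy |]; intros u Hu; now rewrite Hg by auto.
  - rewrite <- (is_derive_unique _ _ _ Hd2), <- (is_derive_unique _ _ _ Hx2).
    apply Derive_ext_loc, Hloc; [easy |]; intros u Hu; now rewrite Hg by auto. }
assert (Hcurv : forall s, a < s < b ->
  S * kappa s = kappa_basic alpha (s / S + s0)).
{ intros s Hs.
  assert (E : kappa s = 0 + / S * kappa_basic alpha (s / S + s0)).
  { apply (derive_angle_eq theta
      (fun u => phi + theta_basic alpha (u / S + s0)) _ _ s).
    - now apply (D_in_interior D _ _ a b s HD Hs), Hth, HD.
    - apply (is_derive_plus (V := R_NormedModule) (fun _ => phi)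
               (fun u => theta_basic alpha (u / S + s0))).
      + apply (is_derive_const (V := R_NormedModule)).
      + apply is_derive_comp_affine, theta_basic_derive, HI, HD, Hs.
    - now apply Hloc. }
  rewrite E; now field. }
(* One interior point suffices: there [S * kappa] is a basic curvature, so it is positive, as is
   [kappa]. *)
assert (HSpos : 0 < S).
{ assert (Hm : a < (a + b) / 2 < b) by lra.
  specialize (Hcurv _ Hm); specialize (Hpos _ (HD _ Hm)).
  pose proof (kappa_basic_pos alpha ((a + b) / 2 / S + s0)); nra. }
split; [easy |].
intros s Hs; destruct (Hdir s Hs) as [Ec Es].
split; [easy |]; split; [easy |]; split; [now apply Hcurv |].
pose proof (Hpos s (HD s Hs)) as Hks.
pose proof (D_in_interior D _ _ a b s HD Hs (Hk s (HD s Hs))) as Hd.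
pose proof (is_derive_comp_affine _ S s0 s _
              (kappa_basic_derive alpha _ (HI s (HD s Hs)))) as Hb.
apply (is_derive_scal _ _ (/ S)) in Hb.
rewrite <- (is_derive_unique _ _ _ Hd).
transitivity (/ S * (/ S * - Rpower (kappa_basic alpha (s / S + s0)) (alpha + 1))).
- rewrite <- (is_derive_unique _ _ _ Hb).
  apply Derive_ext_loc, Hloc; [easy |].
  intros u Hu; rewrite <- Hcurv by easy; now field.
- rewrite <- Hcurv, <- Rpower_mult_distr by easy.
  (* Two factors [S] of [Rpower S (alpha + 1)] cancel the two [/ S], one from scaling the curvature
     and one from the parameter. *)
  replace (alpha + 1) with (alpha - 1 + (1 + 1)) at 1 by ring.
  rewrite !(Rpower_plus (alpha - 1)), (Rpower_plus 1 1 S), (Rpower_1 S) by easy.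
  now field.
Qed.

(** All four parameters are read off at the interior point [L / 2], where both representations share
    position, direction, curvature and derivative of the curvature. *)
Lemma basic_LAC_form_unique (L alpha : R) (gamma : R -> R * R) (kappa : R -> R)
    (gamma1 gamma2 : R * R) (phi1 phi2 S1 S2 s1 s2 : R) :
  alpha <> 1 -> 0 < L -> is_LAC (closed_interval 0 L) alpha gamma kappa ->
  (forall s, closed_interval 0 L s -> 0 < kappa s) ->
  is_basic_LAC_form (closed_interval 0 L) alpha gamma gamma1 phi1 S1 s1 ->
  is_basic_LAC_form (closed_interval 0 L) alpha gamma gamma2 phi2 S2 s2 ->
  gamma1 = gamma2 /\ phi1 = phi2 /\ S1 = S2 /\ s1 = s2.
Proof.
intros Ha HL [[theta [Hg Hth]] [_ [_ [k1 [_ [Hk1 _]]]]]] Hpos F1 F2.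
assert (HD : forall s, 0 < s < L -> closed_interval 0 L s)
  by (unfold closed_interval; intros; lra).
assert (Hm : 0 < L / 2 < L) by lra.
destruct (basic_LAC_form_interior _ 0 L alpha gamma theta kappa k1 _ _ _ _
            HL HD Hg Hth Hk1 Hpos F1) as [HS1 G1].
destruct (basic_LAC_form_interior _ 0 L alpha gamma theta kappa k1 _ _ _ _
            HL HD Hg Hth Hk1 Hpos F2) as [HS2 G2].
destruct (G1 _ Hm) as [Ec1 [Es1 [Ek1 Ed1]]].
destruct (G2 _ Hm) as [Ec2 [Es2 [Ek2 Ed2]]].
destruct F1 as [Hphi1 [_ [HI1 E1]]]; destruct F2 as [Hphi2 [_ [HI2 E2]]].
pose proof (HD _ Hm) as Dm.
(* Both formulas for [k1 (L / 2)] have the same positive factor in [kappa], so the powers of [S1]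
   and [S2] agree, and their exponent is nonzero. *)
assert (ES : S1 = S2).
{ apply (Rpower_inj_base (alpha - 1)); trivial; [lra |].
  assert (0 < Rpower (kappa (L / 2)) (alpha + 1)) by apply exp_pos; nra. }
subst S2.
(* With equal scales, the basic curvature takes the same value at both shifted parameters, and it is
   injective. *)
assert (Es : s1 = s2).
{ pose proof (kappa_basicK _ _ (HI1 _ Dm)) as K1.
  pose proof (kappa_basicK _ _ (HI2 _ Dm)) as K2.
  rewrite <- Ek1 in K1; rewrite <- Ek2, K1 in K2; lra. }
subst s2.
rewrite Ec1 in Ec2; rewrite Es1 in Es2.
destruct (cos_sin_plus_cancel _ _ _ Ec2 Es2) as [Ec Es].
assert (Ephi := angle_unique _ _ Hphi1 Hphi2 Ec Es); subst phi2.
split; [| easy].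
specialize (E1 _ Dm); rewrite (E2 _ Dm) in E1.
unfold similarity in E1; injection E1 as Ex Ey.
rewrite (surjective_pairing gamma1), (surjective_pairing gamma2); f_equal; lra.
Qed.

(** * Length of the segment, and the theorem *)

Lemma xi_arc_length (alpha a b : R) :
  I_basic alpha a -> I_basic alpha b -> a <= b -> arc_length (xi alpha) a b = b - a.
Proof.
intros Ha Hb Hab; unfold arc_length.
rewrite Rmin_left, Rmax_right by easy.
rewrite (RInt_ext _ (fun _ => 1)).
- rewrite RInt_const; unfold scal; simpl; unfold mult; simpl; ring.
- rewrite Rmin_left, Rmax_right by easy; intros t Ht.
  assert (HI : I_basic alpha t)
    by (unfold I_basic in *; destruct (Rle_dec 0 alpha); nra).
  destruct (xi_derive alpha t HI) as [H1 H2].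
  rewrite (is_derive_unique (fun u : R => fst (xi alpha u)) t _ H1),
    (is_derive_unique (fun u : R => snd (xi alpha u)) t _ H2).
  rewrite <- sqrt_1; f_equal.
  pose proof (sin2_cos2 (theta_basic alpha t)) as H; unfold Rsqr in H; lra.
Qed.

Theorem proposition2p3 (alpha : R) (halpha : alpha <> 1) :
  (forall (D : R -> Prop) (gamma : R -> R * R) (kappa : R -> R),
     nondegenerate_interval D ->
     is_LAC D alpha gamma kappa ->
     (forall s, D s -> 0 < kappa s) ->
     strictly_decreasing_on D kappa ->
     exists (gamma0 : R * R) (phi S s0 : R),
       is_basic_LAC_form D alpha gamma gamma0 phi S s0)
  /\
  (forall (L : R) (gamma : R -> R * R) (kappa : R -> R),
     0 < L ->
     is_LAC (closed_interval 0 L) alpha gamma kappa ->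
     (forall s, closed_interval 0 L s -> 0 < kappa s) ->
     strictly_decreasing_on (closed_interval 0 L) kappa ->
     exists (gamma0 : R * R) (phi S s0 : R),
       is_basic_LAC_form (closed_interval 0 L) alpha gamma gamma0 phi S s0 /\
       arc_length (xi alpha) s0 (L / S + s0) = L / S /\
       (forall (gamma0' : R * R) (phi' S' s0' : R),
          is_basic_LAC_form (closed_interval 0 L) alpha gamma gamma0' phi' S' s0' ->
          gamma0' = gamma0 /\ phi' = phi /\ S' = S /\ s0' = s0)).
Proof.
split; [intros; now apply basic_LAC_form_exists with kappa |].
intros L gamma kappa HL HLAC Hpos Hdec.
assert (HD : nondegenerate_interval (closed_interval 0 L)).
{ unfold closed_interval; split; [intros; lra | exists 0, L; lra]. }
destruct (basic_LAC_form_exists _ alpha gamma kappa halpha HD HLAC Hpos Hdec)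
  as [gamma0 [phi [S [s0 F]]]].
exists gamma0, phi, S, s0; split; [easy |]; split.
- destruct HLAC as [[theta [Hg Hth]] [_ [_ [k1 [_ [Hk1 _]]]]]].
  (* The form itself gives only [S <> 0]; positivity puts the ends [s0] and [L / S + s0] of the
     segment in order. *)
  destruct (basic_LAC_form_interior (closed_interval 0 L) 0 L alpha gamma theta
              kappa k1 gamma0 phi S s0) as [HS _]; trivial.
  { unfold closed_interval; intros; lra. }
  destruct F as [_ [_ [HI _]]].
  assert (0 < L / S) by now apply Rdiv_lt_0_compat.
  rewrite xi_arc_length; [ring | | | lra].
  + replace s0 with (0 / S + s0) by (field; lra).
    apply HI; unfold closed_interval; lra.
  + apply HI; unfold closed_interval; lra.
- intros; eapply basic_LAC_form_unique; eassumption.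
Qed.
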